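(* Let $\mathfrak{G}=\langle\mathbb{N},\leqslant\rangle$ and let $L$ be a superintuitionistic predicate logic such that $\mathsf{QSIL}^{e}\,\mathfrak{G}\subseteq L\subseteq \mathsf{QSIL}(\mathfrak{G}\odot\mathbb{N})$. Then the fragment of $L$ consisting of its formulas in the language with two individual variables, a single binary predicate letter, and infinitely many unary predicate letters is both $\Sigma^0_1$-hard and $\Pi^0_1$-hard.
   Context: Language: $\mathcal{L}$ is the predicate language (no equality, no function symbols or constants) with countably many individual variables, countably many predicate letters of every arity (nullary ones are proposition letters), $\bot$, $\wedge,\vee,\to$, $\forall,\exists$; $\neg\varphi$ abbreviates $\varphi\to\bot$. Semantics: a Kripke frame is $\mathfrak{F}=\langle W,R\rangle$ with $W\neq\varnothing$ and $R$ a partial order on $W$ (only such intuitionistic frames are considered). An augmented frame over $\mathfrak{F}$ is $\mathfrak{F}_D=\langle W,R,D\rangle$ where $D$ assigns to each $w\in W$ a non-empty set $D_w$ with $D_u\subseteq D_w$ whenever $uRw$. $\mathfrak{F}\odot\mathcal{D}$ denotes the augmented frame over $\mathfrak{F}$ with $D_w=\mathcal{D}$ for all $w$. A model over $\mathfrak{F}_D$ has an interpretation $I$ with $I(w,P)\subseteq D_w^n$ for each $n$-ary letter $P$ and $I(w,P)\subseteq I(w',P)$ whenever $wRw'$. Truth at $w$: atoms according to $I(w,\cdot)$; $\bot$ never true; $\wedge,\vee$ pointwise; $\varphi\to\psi$ is true at $w$ iff for every $v$ with $wRv$, truth of $\varphi$ at $v$ implies truth of $\psi$ at $v$; $\forall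 x\,\varphi$ is true at $w$ iff for every $v$ with $wRv$ and every $a\in D_v$, $\varphi(a)$ is true at $v$; $\exists x\,\varphi$ is true at $w$ iff $\varphi(a)$ is true at $w$ for some $a\in D_w$. A formula is valid on $\mathfrak{F}_D$ if it is true at every world $w$ of every model over $\mathfrak{F}_D$ under every assignment of elements of $D_w$ to its free variables. $\mathsf{QSIL}(\mathfrak{F}_D)$ is the set of $\mathcal{L}$-formulas valid on $\mathfrak{F}_D$, and $\mathsf{QSIL}^{e}\,\mathfrak{F}$ is the set of $\mathcal{L}$-formulas valid on all augmented frames over $\mathfrak{F}$. Logics: $\mathbf{QInt}$ is the set of $\mathcal{L}$-formulas valid on every augmented frame over every (intuitionistic) Kripke frame. A superintuitionistic predicate logic is a set of $\mathcal{L}$-formulas including $\mathbf{QInt}$ and closed under Modus Ponens, Substitution (of formulas for predicate letters), and Generalization. Hardness is with respect to computable many-one reductions. *)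

(* Defs.v *)
From Stdlib Require List.
From mathcomp Require Import all_boot classical_sets.

Set Implicit Arguments.
Unset Strict Implicit.
Unset Printing Implicit Defensive.

Local Open Scope classical_set_scope.

(* Individual variables are natural numbers.  For all n and k there is one     *)
(* n-ary predicate letter P^n_k; its arity is not stored in an atom but read   *)
(* off its list of arguments, so that Atom k [:: x_1; ...; x_n] is the formula *)
(* P^n_k(x_1, ..., x_n).                                                       *)
Inductive form : Type :=
| Atom of nat & seq nat
| Bot
| And of form & form
| Or of form & form
| Imp of form & form
| All of nat & form
| Ex of nat & form.

Fixpoint fv (phi : form) : seq nat :=
  match phi with
  | Atom _ xs => xs
  | Bot => [::]
  | And a b | Or a b | Imp a b => fv a ++ fv b
  | All x a | Ex x a => [seq y <- fv a | y != x]
  end.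

(** * Kripke semantics *)

Record kframe : Type := KFrame {
  world :> Type;
  acc : world -> world -> Prop;
  world_inhabited : inhabited world;
  acc_refl : forall w, acc w w;
  acc_trans : forall u v w, acc u v -> acc v w -> acc u w;
  acc_antisym : forall u v, acc u v -> acc v u -> u = v
}.

(* The domains D_w are subsets of a common type of individuals. *)
Record aframe (F : kframe) : Type := AFrame {
  indiv : Type;
  dom : F -> set indiv;
  dom_nonempty : forall w, dom w !=set0;
  dom_mono : forall u w, acc u w -> dom u `<=` dom w
}.

Definition const_aframe (F : kframe) (D : Type) (D0 : inhabited D) : aframe F :=
  @AFrame F D (fun=> setT)
    (fun=> let: inhabits a := D0 in ex_intro _ a Logic.I)
    (fun _ _ _ => @subset_refl D setT).

(* interp w k s holds iff s = [:: a_1; ...; a_n] belongs to I(w, P^n_k).  *)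
Record model (F : kframe) (A : aframe F) : Type := Model {
  interp : F -> nat -> set (seq (indiv A));
  interp_dom : forall w k s, interp w k s -> List.Forall (dom w) s;
  interp_mono : forall u w k, acc u w -> interp u k `<=` interp w k
}.

Fixpoint forces (F : kframe) (A : aframe F) (M : model A) (w : F)
    (v : nat -> indiv A) (phi : form) : Prop :=
  match phi with
  | Atom k xs => interp M w k (map v xs)
  | Bot => False
  | And a b => forces M w v a /\ forces M w v b
  | Or a b => forces M w v a \/ forces M w v b
  | Imp a b => forall u, acc w u -> forces M u v a -> forces M u v b
  | All x a => forall u, acc w u ->
      forall d, dom u d -> forces M u [eta v with x |-> d] a
  | Ex x a => exists2 d, dom w d & forces M w [eta v with x |-> d] a
  end.

Definition QSIL (F : kframe) (A : aframe F) : set form :=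
  [set phi | forall (M : model A) (w : F) (v : nat -> indiv A),
     (forall x, x \in fv phi -> dom w (v x)) -> forces M w v phi].

Definition QSILe (F : kframe) : set form :=
  [set phi | forall A : aframe F, QSIL A phi].

Definition QInt : set form := [set phi | forall F : kframe, QSILe F phi].

Definition natframe : kframe :=
  @KFrame nat (fun m n => m <= n) (inhabits 0) leqnn
    (fun _ _ _ => @leq_trans _ _ _)
    (fun m n le_mn le_nm => anti_leq (introT andP (conj le_mn le_nm))).

(** * Substitution and superintuitionistic logics *)

(* The name of a bound variable x, changed only if x has to be avoided. *)
Definition rename (x : nat) (avoid : seq nat) : nat :=
  if x \in avoid then (\max_(y <- avoid) y).+1 else x.

(* Capture-avoiding simultaneous substitution of s y for each free y. *)
Fixpoint vsubst (s : nat -> nat) (phi : form) : form :=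
  match phi with
  | Atom k xs => Atom k (map s xs)
  | Bot => Bot
  | And a b => And (vsubst s a) (vsubst s b)
  | Or a b => Or (vsubst s a) (vsubst s b)
  | Imp a b => Imp (vsubst s a) (vsubst s b)
  | All x a => let z := rename x (map s (fv phi)) in
      All z (vsubst [eta s with x |-> z] a)
  | Ex x a => let z := rename x (map s (fv phi)) in
      Ex z (vsubst [eta s with x |-> z] a)
  end.

(* sigma n k = (zs, c) replaces P^n_k(zs) by c, hence P^n_k(xs) by c[xs/zs];  *)
(* the free variables of c that are not in zs are parameters.                 *)
Definition psubstitution := nat -> nat -> seq nat * form.

Definition psubst_wf (sigma : psubstitution) : Prop :=
  forall n k, size (sigma n k).1 = n /\ uniq (sigma n k).1.

Fixpoint params (sigma : psubstitution) (phi : form) : seq nat :=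
  match phi with
  | Atom k xs => let: (zs, c) := sigma (size xs) k in
      [seq y <- fv c | y \notin zs]
  | Bot => [::]
  | And a b | Or a b | Imp a b => params sigma a ++ params sigma b
  | All _ a | Ex _ a => params sigma a
  end.

(* Capture-avoiding substitution of formulas for predicate letters; s records *)
(* the renaming of the bound variables of phi, which keeps them apart from    *)
(* the parameters of sigma.                                                   *)
Fixpoint psubst_rec (sigma : psubstitution) (s : nat -> nat) (phi : form) :
    form :=
  match phi with
  | Atom k xs => let: (zs, c) := sigma (size xs) k in
      vsubst (fun y => nth y (map s xs) (index y zs)) c
  | Bot => Bot
  | And a b => And (psubst_rec sigma s a) (psubst_rec sigma s b)
  | Or a b => Or (psubst_rec sigma s a) (psubst_rec sigma s b)
  | Imp a b => Imp (psubst_rec sigma s a) (psubst_rec sigma s b)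
  | All x a => let z := rename x (map s (fv phi) ++ params sigma a) in
      All z (psubst_rec sigma [eta s with x |-> z] a)
  | Ex x a => let z := rename x (map s (fv phi) ++ params sigma a) in
      Ex z (psubst_rec sigma [eta s with x |-> z] a)
  end.

Definition psubst (sigma : psubstitution) (phi : form) : form :=
  psubst_rec sigma id phi.

Record superint_logic (L : set form) : Prop := SuperintLogic {
  superint_QInt : QInt `<=` L;
  superint_mp : forall a b, L (Imp a b) -> L a -> L b;
  superint_subst : forall sigma a, psubst_wf sigma -> L a -> L (psubst sigma a);
  superint_gen : forall x a, L a -> L (All x a)
}.

(* The formulas whose variables, free or bound, are among x and y and whose   *)
(* predicate letters are P^2_b or unary.                                      *)
Fixpoint in_fragment (x y b : nat) (phi : form) : bool :=
  match phi with
  | Atom k xs => all (mem [:: x; y]) xs &&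
      ((size xs == 1) || ((size xs == 2) && (k == b)))
  | Bot => true
  | And a c | Or a c | Imp a c => in_fragment x y b a && in_fragment x y b c
  | All z a | Ex z a => (z \in [:: x; y]) && in_fragment x y b a
  end.

Definition fragment (x y b : nat) : set form :=
  [set phi | in_fragment x y b phi].

(** * Computability and hardness *)

(* Partial recursive functions.  RPrec f g is the function h with             *)
(* h(0, v) = f(v) and h(k + 1, v) = g(k, h(k, v), v).                         *)
Inductive recfun : nat -> Type :=
| RZero n : recfun n
| RSucc : recfun 1
| RProj n (i : 'I_n) : recfun n
| RComp m n (f : recfun m) (g : 'I_m -> recfun n) : recfun n
| RPrec n (f : recfun n) (g : recfun n.+2) : recfun n.+1
| RMu n (f : recfun n.+1) : recfun n.

Fixpoint reval n (c : recfun n) : n.-tuple nat -> nat -> Prop :=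
  match c in recfun n return n.-tuple nat -> nat -> Prop with
  | RZero _ => fun _ y => y = 0
  | RSucc => fun v y => y = (thead v).+1
  | RProj _ i => fun v y => y = tnth v i
  | RComp m _ f g => fun v y => exists2 w : m.-tuple nat,
      (forall i, reval (g i) v (tnth w i)) & reval f w y
  | RPrec _ f g => fun v y =>
      let u := behead_tuple v in
      let fix loop k y := match k with
        | 0 => reval f u y
        | j.+1 => exists2 r, loop j r &
            reval g (cons_tuple j (cons_tuple r u)) y
        end in
      loop (thead v) y
  | RMu _ f => fun v y => reval f (cons_tuple y v) 0 /\
      forall z, z < y -> exists r, reval f (cons_tuple z v) r.+1
  end.

Definition computable n (f : n.-tuple nat -> nat) : Prop :=
  exists c : recfun n, forall v, reval c v (f v).

Definition computable_fun (f : nat -> nat) : Prop :=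
  computable (fun v : 1.-tuple nat => f (thead v)).

Definition computable_rel (R : rel nat) : Prop :=
  computable (fun v : 2.-tuple nat =>
    nat_of_bool (R (tnth v ord0) (tnth v ord_max))).

Definition sigma01 (X : set nat) : Prop :=
  exists2 R : rel nat, computable_rel R & forall n, X n <-> exists m, R n m.

Definition pi01 (X : set nat) : Prop :=
  exists2 R : rel nat, computable_rel R & forall n, X n <-> forall m, R n m.

Definition many_one_reducible (X Y : set nat) : Prop :=
  exists2 f : nat -> nat, computable_fun f & forall n, X n <-> Y (f n).

Definition hard (C : set (set nat)) (Y : set nat) : Prop :=
  forall X, C X -> many_one_reducible X Y.

Fixpoint goedel (phi : form) : nat :=
  CodeSeq.code
    match phi with
    | Atom k xs => [:: 0, k & xs]
    | Bot => [:: 1]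
    | And a b => [:: 2; goedel a; goedel b]
    | Or a b => [:: 3; goedel a; goedel b]
    | Imp a b => [:: 4; goedel a; goedel b]
    | All x a => [:: 5; x; goedel a]
    | Ex x a => [:: 6; x; goedel a]
    end.

Lemma goedel_inj : injective goedel.
Proof.
elim=> [k xs||a IHa b IHb|a IHa b IHb|a IHa b IHb|x a IHa|x a IHa]
        [l ys||c d|c d|c d|y c|y c] /(can_inj CodeSeq.codeK) // [].
- by move=> -> ->.
- by move=> /IHa -> /IHb ->.
- by move=> /IHa -> /IHb ->.
- by move=> /IHa -> /IHb ->.
- by move=> -> /IHa ->.
- by move=> -> /IHa ->.
Qed.

Definition sigma01_hard (A : set form) : Prop := hard sigma01 (goedel @` A).

Definition pi01_hard (A : set form) : Prop := hard pi01 (goedel @` A).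

(* Main.v *)
Require Import Defs.
From mathcomp Require Import all_boot classical_sets boolp.

(** Over the frame of the natural numbers a persistent unary letter P gives
    each individual a its height, the first world where P(a) holds.  The
    implication P_l(t) -> P_k(s) is forced exactly when the P_k-height of s is
    at most the P_l-height of t, and ((P_k(s) -> P_l(t)) -> P_l(t)) exactly when
    it is smaller, provided that the heights are finite and lie above the world
    of evaluation (forces_le, forces_lt).  Hence a positive combination of such
    literals, forced at one world w, says classically about the individuals
    of D_w what it seems to say about their heights (holds_of_forces); the
    converse is also true for constant domains (forces_of_holds).  The proviso
    is the antecedent all_finite and the failure of some_low, so it holds
    wherever an implication

      all_finite /\ (positive combination) -> some_low

    is refuted.

    With finitely many letters an individual is thus a record of natural
    numbers, and two variables are enough to describe computations.  An
    individual stands for a fact p(t_0, t_1, ...), for instance: the partial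
    recursive function c takes the value t_0 at (t_1, ..., t_n).  A rule says
    that every fact of kind p is supported by other facts, whose arguments are
    among its own; two variables can express it, because auxiliary values
    are extra fields of the record.  Heights are compared but not computed
    with, so numbers are read off by rank: the value of a height is the number
    of smaller heights of one distinguished letter (the number letter).  That t
    is the successor of s then means that s < t, that s is the number height of
    some individual, and that none lies strictly between; again two variables
    suffice.

    In a supported set of facts all evaluation facts are true (rules_sound):
    the recursions of the rules go down along natural numbers, and those are
    well-founded because heights are worlds of the frame.  Conversely the
    true facts form a supported set (rules_complete), which gives a
    refuting model with constant domain (refutable_of_supported).  So if a rule
    system has a supported set with an initial fact of argument n exactly when
    n is not in X, then X reduces to the fragment of L (reduction).  For X in
    Pi_1 the initial fact needs one m that refutes R(n, m).  For X in
    Sigma_1 it needs m = 0 and each m needs m + 1, so that R(n, m) is refuted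
    for all m.

    The formula for n contains n only through a numeral obtained by iterating
    one formula context, so its Goedel number is computable by composition and
    iteration alone. *)

Set Implicit Arguments.
Unset Strict Implicit.
Unset Printing Implicit Defensive.

Local Open Scope classical_set_scope.

(** * Derivations of partial recursive functions as supported sets of facts *)

Definition kind : Type := seq nat.

(** The argument list of CCall q s gives the fields of the present fact that
    have to agree with the first fields of some fact of kind q. *)
Inductive condition : Type :=
| CTriv
| CEq of nat & nat
| CZero of nat
| CSucc of nat & nat
| CCall of kind & seq nat
| CBoth of condition & condition
| CEither of condition & condition.

Definition rule : Type := (kind * condition)%type.

Section Supported.

Variables (F : Type) (val : F -> nat -> nat).

Fixpoint meets (T : kind -> F -> Prop) (a : F) (c : condition) : Prop :=
  match c with
  | CTriv => True
  | CEq i j => val a i = val a j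
  | CZero i => val a i = 0
  | CSucc i j => val a j = (val a i).+1
  | CCall q s =>
      exists2 a', T q a' & mkseq (val a') (size s) = map (val a) s
  | CBoth c d => meets T a c /\ meets T a d
  | CEither c d => meets T a c \/ meets T a d
  end.

(** T is only required to be a postfixed point of the rules: each of its facts
    is justified within T, possibly by infinite regress. *)
Fixpoint supported (T : kind -> F -> Prop) (rs : seq rule) : Prop :=
  if rs is r :: rs' then
    (forall a, T r.1 a -> meets T a r.2) /\ supported T rs'
  else True.

Lemma supported_cat T rs rs' :
  supported T (rs ++ rs') <-> supported T rs /\ supported T rs'.
Proof. by elim: rs => [|r rs IH] /=; tauto. Qed.

End Supported.

(** Kinds are paths, and prefixing them makes the kinds of the rules of
    different subfunctions disjoint. *)
Fixpoint qualify_cond (i : nat) (c : condition) : condition :=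
  match c with
  | CCall q s => CCall (i :: q) s
  | CBoth c d => CBoth (qualify_cond i c) (qualify_cond i d)
  | CEither c d => CEither (qualify_cond i c) (qualify_cond i d)
  | _ => c
  end.

Definition qualify (i : nat) (rs : seq rule) : seq rule :=
  [seq (i :: r.1, qualify_cond i r.2) | r <- rs].

Lemma meets_qualify F val T (a : F) i c :
  meets val T a (qualify_cond i c) <-> meets val (fun q => T (i :: q)) a c.
Proof. by elim: c => //= c IHc d IHd; tauto. Qed.

Lemma supported_qualify F (val : F -> nat -> nat) T i rs :
  supported val T (qualify i rs) <-> supported val (fun q => T (i :: q)) rs.
Proof.
elim: rs => //= r rs IH; split=> -[H Hs]; (split; last by apply/IH) => a /H;
  by move/meets_qualify.
Qed.

(** Field 0 of a fact of kind [::] is the value, fields 1 to n are the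
    arguments, and the following ones are auxiliary: the intermediate values of
    a composition, the predecessor j of the recursion argument with the value r
    at j, or, for minimization, the number zero. A fact of kind [:: 1] of RMu f
    says that f takes positive values at all numbers below its field 0; its
    field r' is the predecessor of the value r, which makes r positive. *)
Fixpoint rules n (c : recfun n) : seq rule :=
  match c with
  | RZero _ => [:: ([::], CZero 0)]
  | RSucc => [:: ([::], CSucc 1 0)]
  | RProj _ i => [:: ([::], CEq i.+1 0)]
  | RComp m n f g =>
      ([::], CBoth (CCall [:: 0] (0 :: iota n.+1 m))
               (foldr (fun i : 'I_m => CBoth
                         (CCall [:: i.+1] (n.+1 + i :: iota 1 n)))
                  CTriv (enum 'I_m)))
      :: qualify 0 (rules f)
         ++ flatten [seq qualify (i : 'I_m).+1 (rules (g i)) | i <- enum 'I_m]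
  | RPrec n f g =>
      let j := n.+2 in let r := n.+3 in
      ([::], CEither
               (CBoth (CZero 1) (CCall [:: 0] (0 :: iota 2 n)))
               (CBoth (CSucc j 1)
                  (CBoth (CCall [::] [:: r, j & iota 2 n])
                     (CCall [:: 1] [:: 0, j, r & iota 2 n]))))
      :: qualify 0 (rules f) ++ qualify 1 (rules g)
  | RMu n f =>
      let z := n.+1 in let j := n.+1 in let r := n.+2 in let r' := n.+3 in
      [:: ([::], CBoth (CCall [:: 1] (0 :: iota 1 n))
                   (CBoth (CZero z) (CCall [:: 0] [:: z, 0 & iota 1 n]))),
          ([:: 1], CEither (CZero 0)
                     (CBoth (CSucc j 0)
                        (CBoth (CCall [:: 1] (j :: iota 1 n))
                           (CBoth (CSucc r' r)
                              (CCall [:: 0] [:: r, j & iota 1 n])))))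
        & qualify 0 (rules f)]
  end.

Lemma reval_prec0 n (f : recfun n) (g : recfun n.+2) (u : n.-tuple nat) y :
  reval (RPrec f g) (cons_tuple 0 u) y <-> reval f u y.
Proof.
rewrite /= (_ : behead_tuple (cons_tuple 0 u) = u) //; exact: val_inj.
Qed.

Lemma reval_precS n (f : recfun n) (g : recfun n.+2) k (u : n.-tuple nat) y :
  reval (RPrec f g) (cons_tuple k.+1 u) y <->
  exists2 r, reval (RPrec f g) (cons_tuple k u) r &
    reval g (cons_tuple k (cons_tuple r u)) y.
Proof.
rewrite /= (_ : behead_tuple (cons_tuple k.+1 u) = u); last exact: val_inj.
by rewrite (_ : behead_tuple (cons_tuple k u) = u) //; exact: val_inj.
Qed.

Lemma reval_functional n (c : recfun n) v y y' :
  reval c v y -> reval c v y' -> y = y'.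
Proof.
elim: n / c v y y' =>
  [n||n i|m n f IHf g IHg|n f IHf g IHg|n f IHf] v y y'.
- by move=> /= -> ->.
- by move=> /= -> ->.
- by move=> /= -> ->.
- move=> /= [w Hw Hy] [w' Hw' Hy'].
  have eqw : w = w' by apply: eq_from_tnth => i; apply: IHg (Hw i) (Hw' i).
  by subst w'; apply: IHf Hy Hy'.
- case/tupleP: v => k u; elim: k y y' => [|k IHk] y y'.
    by move=> /reval_prec0 Hy /reval_prec0; apply: IHf.
  move=> /reval_precS[r Hr Hy] /reval_precS[r' Hr' Hy'].
  by move: Hy'; rewrite -(IHk _ _ Hr Hr'); apply: IHg.
- move=> /= [Hy ltyP] [Hy' lty'P].
  case: (ltngtP y y') => // lt.
    by have [r Hr] := lty'P _ lt; have := IHf _ _ _ Hy Hr.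
  by have [r Hr] := ltyP _ lt; have := IHf _ _ _ Hy' Hr.
Qed.

Lemma meets_foldr F val T (a : F) (I : eqType) (B : I -> condition) s :
  meets val T a (foldr (fun i => CBoth (B i)) CTriv s) <->
  forall i, i \in s -> meets val T a (B i).
Proof.
elim: s => [|i s IH] /=; first by split.
split=> [[Hi /IH Hs] j|H]; first by rewrite inE => /predU1P[->|/Hs].
split; first by apply: H; rewrite mem_head.
by apply/IH => j js; apply: H; rewrite inE js orbT.
Qed.

Lemma supported_flatten F (val : F -> nat -> nat) T (I : eqType)
    (R : I -> seq rule) s :
  supported val T (flatten [seq R i | i <- s]) <->
  forall i, i \in s -> supported val T (R i).
Proof.
elim: s => [|i s IH] /=; first by split.
rewrite supported_cat IH; split=> [[Hi Hs] j|H].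
  by rewrite inE => /predU1P[->|/Hs].
split; first by apply: H; rewrite mem_head.
by move=> j js; apply: H; rewrite inE js orbT.
Qed.

(** Although support may be infinite regress in general, the rules only go from
    a function to a subfunction, or to the same function with a smaller number
    in one field. *)
Lemma rules_sound n (c : recfun n) F (val : F -> nat -> nat) T :
  supported val T (rules c) ->
  forall a (v : n.-tuple nat), T [::] a ->
  v = map (val a) (iota 1 n) :> seq nat -> reval c v (val a 0).
Proof.
elim: n / c T => [n||n i|m n f IHf g IHg|n f IHf g IHg|n f IHf] T.
- by move=> /= [H _] a v /H.
- move=> /= [H _] a v /H -> vE.
  by rewrite /thead (tnth_nth 0) vE.
- move=> /= [H _] a v /H <- vE.
  by rewrite (tnth_nth 0) vE (nth_map 0) ?size_iota // nth_iota.
- move=> [root] /supported_cat[/supported_qualify/IHf{}IHf].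
  move=> /supported_flatten/= Hg a v /root[[b /IHf{}IHf]].
  rewrite /= ?size_iota => -[b0 bw] /meets_foldr Hw vE.
  exists [tuple val a (n.+1 + i) | i < m]; last first.
    rewrite -b0; apply: IHf.
    rewrite bw -[in iota _ _](addn0 n.+1) iotaDl -val_enum_ord.
    by rewrite -[RHS]map_comp -[RHS]map_comp; apply: eq_map.
  move=> i; rewrite tnth_mktuple.
  have /supported_qualify/IHg{}IHg := Hg i (mem_enum _ i).
  have [b' /IHg{}IHg /=] := Hw i (mem_enum _ i).
  rewrite size_iota => -[<- bv]; apply: IHg.
  by rewrite vE bv.
- move=> [root] /supported_cat[/supported_qualify/IHf{}IHf].
  move=> /supported_qualify/IHg{}IHg a v Ta.
  case/tupleP: v => k u [].
  elim: k a u Ta => [|k IHk] a u Ta ak au.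
    apply/reval_prec0; have [[_]|[]] /= := root _ Ta; last by rewrite -ak.
    case=> b /IHf{}IHf; rewrite size_iota => -[<- bu].
    by apply: IHf; rewrite au bu.
  apply/reval_precS.
  have [[]|[aj [call1 call2]]] /= := root _ Ta.
    by rewrite -ak.
  move: aj; rewrite /= -ak => -[kE].
  case: call1 => b Tb; rewrite /= ?size_iota => -[b0 b1 bu].
  case: call2 => b' /IHg{}IHg; rewrite /= ?size_iota => -[<- b'1 b'2 b'u].
  exists (val a n.+3); last by apply: IHg; rewrite /= b'1 b'2 b'u -kE au.
  by rewrite -b0; apply: IHk; rewrite // ?b1 // bu au.
- move=> [root [below]] /supported_qualify/IHf{}IHf a v /root.
  move=> [[b Tb] /=]; rewrite size_iota => -[b0 bv].
  case=> az [b' /IHf{}IHf']; rewrite /= ?size_iota.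
  rewrite az => -[b'0 b'1 b'v] vE.
  split.
    have := IHf' (cons_tuple (val a 0) v); rewrite b'0; apply.
    by rewrite /= b'1 b'v vE.
  rewrite -b0; have bvE : v = map (val b) (iota 1 n) :> seq nat by rewrite bv.
  move kE: (val b 0) => k.
  elim: k b Tb kE bvE {b0 bv b'0 b'1 b'v} => [|k IHk] b Tb bk bv z //.
  have [|[bj [call1 [br call2]]]] /= := below _ Tb; first by rewrite bk.
  case: call1 => d Td; rewrite /= ?size_iota => -[d0 dv].
  move: bj; rewrite /= bk => -[kE].
  rewrite ltnS leq_eqVlt => /predU1P[->|]; last first.
    by apply: (IHk d) => //; rewrite ?d0 // dv.
  case: call2 => d' /IHf Hd'; rewrite /= ?size_iota => -[d'0 d'1 d'v].
  exists (val b n.+3); move: br d'0 => /= <- <-.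
  by apply: Hd'; rewrite /= d'1 d'v kE bv.
Qed.

Lemma nth_aux n (v : n.-tuple nat) aux k :
  nth 0 (v ++ aux) (k + n) = nth 0 aux k.
Proof. by rewrite nth_cat size_tuple ltnNge leq_addl addnK. Qed.

Lemma map_nth_inputs p n (v : n.-tuple nat) aux :
  [seq nth 0 (p ++ v ++ aux) k | k <- iota (size p) n] = v.
Proof.
rewrite map_nth_iota ?drop_size_cat ?take_size_cat ?size_tuple //.
by rewrite !size_cat size_tuple addKn leq_addr.
Qed.

(** The form in which a rule is checked below: the fact called is given by the
    prefix s' of its fields that the call prescribes. *)
Lemma meets_call T q t s s' aux :
  T q (s' ++ aux) -> map (nth 0 t) s = s' -> meets (nth 0) T t (CCall q s).
Proof.
move=> Tq sE; exists (s' ++ aux) => //.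
rewrite sE -(size_map (nth 0 t)) sE -[RHS](mkseq_nth 0).
apply/eq_in_map => i.
by rewrite mem_iota nth_cat => /andP[_ ->].
Qed.

(** The supported set consists of the true facts that carry the right auxiliary
    values. *)
Lemma rules_complete n (c : recfun n) :
  exists2 T : kind -> seq nat -> Prop, supported (nth 0) T (rules c) &
    forall v y, reval c v y -> exists aux, T [::] (y :: v ++ aux).
Proof.
elim: n / c => [n||n i|m n f [Tf fS fC] g IHg|n f [Tf fS fC] g [Tg gS gC]
  |n f [Tf fS fC]].
- exists (fun _ t => nth 0 t 0 = 0); first by [].
  by move=> v y ->; exists [::].
- exists (fun _ t => nth 0 t 0 = (nth 0 t 1).+1); first by [].
  by move=> v y ->; exists [::]; case/tupleP: v.
- exists (fun _ t => nth 0 t i.+1 = nth 0 t 0); first by [].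
  by move=> v y ->; exists [::]; rewrite cats0 /= (tnth_nth 0).
- have /choice[Tg HTg] (i : nat) : exists T : kind -> seq nat -> Prop,
    forall j : 'I_m, i = j -> supported (nth 0) T (rules (g j)) /\
      forall v y, reval (g j) v y -> exists aux, T [::] (y :: v ++ aux).
    case: (ltnP i m) => [lt_im|le_mi]; last first.
      exists (fun _ _ => True) => j ij.
      by move: le_mi; rewrite ij leqNgt ltn_ord.
    have [T TS TC] := IHg (Ordinal lt_im).
    by exists T => j ij; rewrite (_ : j = Ordinal lt_im) //; apply: val_inj.
  exists (fun p t => match p with
    | [::] => exists (v : n.-tuple nat) (w : m.-tuple nat) y,
        [/\ t = y :: v ++ w, forall i, reval (g i) v (tnth w i) & reval f w y]
    | 0 :: q => Tf q t
    | i.+1 :: q => Tg i q t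
    end); last first.
    by move=> v y [w gw fy]; exists w, v, w, y.
  split.
    move=> t [v [w [y [-> gw fw]]]]; split.
      have [aux Tfy] := fC _ _ fw.
      apply: (meets_call (s' := y :: w) (aux := aux)) => //=.
      rewrite -[in RHS](map_nth_inputs (y :: v) w [::]) /= size_tuple cats0.
      by [].
    apply/meets_foldr => i _.
    have [_ /(_ _ _ (gw i))[aux Tgy]] := HTg i i erefl.
    apply: (meets_call (s' := tnth w i :: v) (aux := aux)) => //=.
    rewrite addnC nth_aux -tnth_nth; congr (_ :: _).
    exact: (map_nth_inputs [:: y] v w).
  apply/supported_cat; split; first exact/supported_qualify.
  apply/supported_flatten => i _; apply/supported_qualify.
  by have [] := HTg i i erefl.
- pose root (t : seq nat) := exists (u : n.-tuple nat) y,
    (t = [:: y, 0 & u] /\ reval f u y) \/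
    exists k r, [/\ t = [:: y, k.+1 & u ++ [:: k; r]],
      reval (RPrec f g) (cons_tuple k u) r &
      reval g (cons_tuple k (cons_tuple r u)) y].
  have rootC v y : reval (RPrec f g) v y -> exists aux, root (y :: v ++ aux).
    case/tupleP: v => -[|k] u.
      move=> /reval_prec0 Hy; exists [::]; rewrite cats0.
      by exists u, y; left.
    move=> /reval_precS[r Hr Hy]; exists [:: k; r], u, y.
    by right; exists k, r.
  exists (fun p t => match p with
    | [::] => root t | 0 :: q => Tf q t | _ :: q => Tg q t
    end) => //.
  split; last by apply/supported_cat; split; apply/supported_qualify.
  move=> t [u [y [[-> fy]|[k [r [-> Hr Hy]]]]]].
    left; split=> //; have [aux Tfy] := fC _ _ fy.
    apply: (meets_call (s' := y :: u) (aux := aux)) => //=.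
    by have /= := map_nth_inputs [:: y; 0] u [::]; rewrite cats0 => ->.
  have uE := map_nth_inputs [:: y; k.+1] u [:: k; r].
  right; split; first by rewrite /= (nth_aux u _ 0).
  split.
    have [aux Tr] := rootC _ _ Hr.
    apply: (meets_call (s' := [:: r, k & u]) (aux := aux)) => //.
    by rewrite /= (nth_aux u _ 0) (nth_aux u _ 1) uE.
  have [aux Ty] := gC _ _ Hy.
  apply: (meets_call (s' := [:: y, k, r & u]) (aux := aux)) => //.
  by rewrite /= (nth_aux u _ 0) (nth_aux u _ 1) uE.
- pose positive (v : n.-tuple nat) z :=
    forall k, k < z -> exists r, reval f (cons_tuple k v) r.+1.
  pose below (t : seq nat) := exists v : n.-tuple nat,
    t = 0 :: v :> seq nat \/
    exists k r, [/\ t = k.+1 :: v ++ [:: k; r.+1; r], positive v k &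
      reval f (cons_tuple k v) r.+1].
  have belowC v z : positive v z -> exists aux, below (z :: v ++ aux).
    case: z => [|k] Hv; first by exists [::], v; left; rewrite cats0.
    have [r Hr] := Hv _ (leqnn _).
    exists [:: k; r.+1; r], v; right; exists k, r; split=> // z /ltnW.
    exact: Hv.
  exists (fun p t => match p with
    | [::] => exists (v : n.-tuple nat) y,
        [/\ t = y :: v ++ [:: 0], reval f (cons_tuple y v) 0 & positive v y]
    | 0 :: q => Tf q t
    | _ => below t
    end); last by move=> v y [Hy ltyP]; exists [:: 0], v, y.
  split.
    move=> t [v [y [-> Hy ltyP]]]; have vE := map_nth_inputs [:: y] v [:: 0].
    split.
      have [aux Tz] := belowC _ _ ltyP.
      by apply: (meets_call (s' := y :: v) (aux := aux)); rewrite //= vE.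
    split; first by rewrite /= (nth_aux v _ 0).
    have [aux Ty] := fC _ _ Hy.
    apply: (meets_call (s' := [:: 0, y & v]) (aux := aux)) => //.
    by rewrite /= (nth_aux v _ 0) vE.
  split; last exact/supported_qualify.
  move=> t [v [->|[k [r [-> ltkP Hr]]]]]; first by left.
  have vE := map_nth_inputs [:: k.+1] v [:: k; r.+1; r].
  right; split; first by rewrite /= (nth_aux v _ 0).
  split.
    have [aux Tk] := belowC _ _ ltkP.
    apply: (meets_call (s' := k :: v) (aux := aux)) => //.
    by rewrite /= (nth_aux v _ 0) vE.
  split; first by rewrite /= (nth_aux v _ 1) (nth_aux v _ 2).
  have [aux Tr] := fC _ _ Hr.
  apply: (meets_call (s' := [:: r.+1, k & v]) (aux := aux)) => //.
  by rewrite /= (nth_aux v _ 0) (nth_aux v _ 1) vE.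
Qed.

(** * Comparing the heights of unary atoms *)

(** Negation is absent, because it can be pushed down to the literals, and QLe
    and QLt are each other's negations up to exchanging the sides. *)
Inductive hformula : Type :=
| QTriv
| QLe of nat & nat & nat & nat
| QLt of nat & nat & nat & nat
| QAnd of hformula & hformula
| QOr of hformula & hformula
| QAll of nat & hformula
| QEx of nat & hformula.

Fixpoint holds T (D : set T) (h : nat -> T -> nat) (v : nat -> T)
    (c : hformula) : Prop :=
  match c with
  | QTriv => True
  | QLe k s l t => h k (v s) <= h l (v t)
  | QLt k s l t => h k (v s) < h l (v t)
  | QAnd c d => holds D h v c /\ holds D h v d
  | QOr c d => holds D h v c \/ holds D h v d
  | QAll x c => forall a, D a -> holds D h [eta v with x |-> a] c
  | QEx x c => exists2 a, D a & holds D h [eta v with x |-> a] c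
  end.

Fixpoint letters (c : hformula) : seq nat :=
  match c with
  | QTriv => [::]
  | QLe k _ l _ | QLt k _ l _ => [:: k; l]
  | QAnd c d | QOr c d => letters c ++ letters d
  | QAll _ c | QEx _ c => letters c
  end.

Definition top : form := Imp Bot Bot.
Definition unary (k s : nat) : form := Atom k [:: s].

Fixpoint formula (c : hformula) : form :=
  match c with
  | QTriv => top
  | QLe k s l t => Imp (unary l t) (unary k s)
  | QLt k s l t => Imp (Imp (unary k s) (unary l t)) (unary l t)
  | QAnd c d => And (formula c) (formula d)
  | QOr c d => Or (formula c) (formula d)
  | QAll x c => All x (formula c)
  | QEx x c => Ex x (formula c)
  end.

Lemma forces_mono (F : kframe) (A : aframe F) (M : model A) u w v phi :
  acc u w -> forces M u v phi -> forces M w v phi.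
Proof.
elim: phi u w v => [k xs||a IHa b IHb|a IHa b IHb|a _ b _|x a _|x a IHa] u w v
  uw //=.
- exact: interp_mono.
- by case=> /(IHa _ _ _ uw) ? /(IHb _ _ _ uw).
- by case=> [/(IHa _ _ _ uw)|/(IHb _ _ _ uw)]; [left|right].
- by move=> H z wz; apply: H; apply: acc_trans uw wz.
- by move=> H z wz; apply: H; apply: acc_trans uw wz.
- case=> d ud /(IHa _ _ _ uw) Hd; exists d => //; exact: (dom_mono uw).
Qed.

Section Heights.

Variables (A : aframe natframe) (M : model A) (w : nat) (ls : seq nat).

Local Notation domain := (@dom natframe A).

(** The heights of letters in ls are required to be finite and to lie above w,
    without which the strict literals would lose their meaning. *)
Definition heights (h : nat -> indiv A -> nat) : Prop :=
  forall k a, k \in ls -> domain w a ->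
    w < h k a /\ forall u, w <= u -> (interp M u k [:: a] <-> h k a <= u).

Section Literals.

Variables (h : nat -> indiv A -> nat) (hP : heights h).

Lemma forces_le k s l t v : k \in ls -> l \in ls ->
  domain w (v s) -> domain w (v t) ->
  forces M w v (formula (QLe k s l t)) <->
  h k (v s) <= h l (v t).
Proof.
move=> kls lls vs vt.
have [_ ks] := hP kls vs; have [/ltnW wlt lt] := hP lls vt.
split=> [H|le_st u wu /= Hl].
  by apply/ks; [exact: wlt | apply: H => //; exact/lt].
by apply/ks => //; apply: leq_trans le_st _; apply/lt.
Qed.

(** If the k-height is the smaller one, then the premise P_k(s) -> P_l(t) is
    forced only from the l-height on, where P_l(t) holds anyway. Otherwise the
    premise is forced at w already, where P_l(t) fails. *)
Lemma forces_lt k s l t v : k \in ls -> l \in ls ->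
  domain w (v s) -> domain w (v t) ->
  forces M w v (formula (QLt k s l t)) <->
  h k (v s) < h l (v t).
Proof.
move=> kls lls vs vt.
have [wks ks] := hP kls vs; have [wlt lt] := hP lls vt.
split=> [H|lt_st u wu /= Hl].
  rewrite ltnNge; apply/negP => le_ts.
  have /(lt _ (leqnn w)) : interp M w l [:: v t].
    apply: (H w) => //= u wu /ks ksu; apply/lt => //.
    exact: leq_trans le_ts (ksu wu).
  by rewrite leqNgt wlt.
apply/lt => //; rewrite leqNgt; apply/negP => lt_u.
(* P_k(s) holds at u' but P_l(t) does not yet, which refutes the premise. *)
pose u' := maxn u (h k (v s)).
have wu' : w <= u' by rewrite leq_max wu.
have /(lt _ wu') : interp M u' l [:: v t].
  apply: Hl; first exact: leq_maxl.
  by apply/ks => //; exact: leq_maxr.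
by rewrite leqNgt gtn_max lt_u lt_st.
Qed.

(** Individuals that enter the domain after w restrict nothing: a universal
    quantifier forced at w also speaks of D_w, and an existential one is
    witnessed in D_w. *)
Lemma holds_of_forces c v :
  {subset letters c <= ls} ->
  (forall s, s \in fv (formula c) -> domain w (v s)) ->
  forces M w v (formula c) -> holds (domain w) h v c.
Proof.
elim: c v => [|k s l t|k s l t|c IHc d IHd|c IHc d IHd|x c IHc|x c IHc] v
  cls vD //.
- by move/forces_le; apply; rewrite ?cls ?inE ?eqxx ?orbT //; apply: vD;
    rewrite !inE eqxx ?orbT.
- by move/forces_lt; apply; rewrite ?cls ?inE ?eqxx ?orbT //; apply: vD;
    rewrite !inE eqxx ?orbT.
- case=> Hc Hd; split; [apply: IHc Hc|apply: IHd Hd] => z zc;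
    by [apply: cls; rewrite mem_cat zc ?orbT
       |apply: vD; rewrite mem_cat zc ?orbT].
- case=> H; [left; apply: IHc H|right; apply: IHd H] => z zc;
    by [apply: cls; rewrite mem_cat zc ?orbT
       |apply: vD; rewrite mem_cat zc ?orbT].
- move=> /= H a Da; apply: IHc => //; last exact: H.
  move=> z zc /=; case: eqVneq => // zx.
  by apply: vD; rewrite mem_filter zx.
- move=> /= [a Da H]; exists a => //; apply: IHc H => //.
  move=> z zc /=; case: eqVneq => // zx.
  by apply: vD; rewrite mem_filter zx.
Qed.

(** A universal quantifier also speaks of later worlds; with a constant domain
    it meets there only individuals already treated at w. *)
Lemma forces_of_holds c v :
  (forall u, w <= u -> domain u `<=` domain w) ->
  {subset letters c <= ls} ->
  (forall s, s \in fv (formula c) -> domain w (v s)) ->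
  holds (domain w) h v c -> forces M w v (formula c).
Proof.
move=> Dconst.
elim: c v => [|k s l t|k s l t|c IHc d IHd|c IHc d IHd|x c IHc|x c IHc] v
  cls vD.
- by move=> _ u _ [].
- move=> /= H; apply/forces_le => //; rewrite ?cls ?inE ?eqxx ?orbT //;
    by apply: vD; rewrite !inE eqxx ?orbT.
- move=> /= H; apply/forces_lt => //; rewrite ?cls ?inE ?eqxx ?orbT //;
    by apply: vD; rewrite !inE eqxx ?orbT.
- case=> Hc Hd; split; [apply: IHc Hc|apply: IHd Hd] => z zc;
    by [apply: cls; rewrite mem_cat zc ?orbT
       |apply: vD; rewrite mem_cat zc ?orbT].
- case=> H; [left; apply: IHc H|right; apply: IHd H] => z zc;
    by [apply: cls; rewrite mem_cat zc ?orbT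
       |apply: vD; rewrite mem_cat zc ?orbT].
- move=> H u wu a /(Dconst _ wu) Da; apply: (forces_mono wu).
  apply: IHc => //; last exact: H.
  move=> z zc /=; case: eqVneq => // zx.
  by apply: vD; rewrite mem_filter zx.
- move=> [a Da H]; exists a => //; apply: IHc H => //.
  move=> z zc /=; case: eqVneq => // zx.
  by apply: vD; rewrite mem_filter zx.
Qed.

End Literals.

(** The double negation of an atom is forced exactly when the atom holds at
    some world, that is, when its height is finite. *)
Definition all_finite (x : nat) : form :=
  foldr (fun k => And (All x (Imp (Imp (unary k x) Bot) Bot))) top ls.

Definition some_low (x : nat) : form :=
  foldr (fun k => Or (Ex x (unary k x))) Bot ls.

Lemma heights_exist x v :
  forces M w v (all_finite x) ->
  ~ forces M w v (some_low x) -> exists h, heights h.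
Proof.
rewrite /all_finite /some_low => fin nlow.
have fin' k a : k \in ls -> domain w a ->
    exists2 u, w <= u & interp M u k [:: a].
  move=> kls Da; apply: contrapT => nex.
  have: forces M w v (All x (Imp (Imp (unary k x) Bot) Bot)).
    elim: (ls) fin kls => //= l ls' IH [Hl Hls].
    by rewrite inE => /predU1P[->|/(IH Hls)].
  move=> /(_ w (leqnn w) _ Da w (leqnn w)); apply=> u wu /=.
  by rewrite eqxx => Hu; apply: nex; exists u.
have low' k a : k \in ls -> domain w a -> ~ interp M w k [:: a].
  move=> kls Da Hw; apply: nlow.
  elim: (ls) kls => //= l ls' IH; rewrite inE => /predU1P[<-|/IH].
    by left; exists a; rewrite //= eqxx.
  by right.
have /choice[h Hh] (ka : nat * indiv A) : exists m,
    ka.1 \in ls -> domain w ka.2 ->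
    w < m /\ forall u, w <= u -> (interp M u ka.1 [:: ka.2] <-> m <= u).
  case: ka => k a /=.
  have [[kls Da]|n] := pselect (k \in ls /\ domain w a); last first.
    by exists 0 => kls Da; case: n.
  have exP : exists u, `[< w <= u /\ interp M u k [:: a] >].
    by have [u wu Hu] := fin' _ _ kls Da; exists u; apply/asboolP.
  case: (ex_minnP exP) => m /asboolP[wm Hm] minm; exists m => _ _.
  split.
    rewrite ltn_neqAle wm andbT; apply/eqP => wE.
    by apply: (low' _ _ kls Da); rewrite wE.
  move=> u wu; split=> [Hu|mu]; first by apply: minm; apply/asboolP.
  exact: (@interp_mono _ _ M m u k mu).
by exists (fun k a => h (k, a)) => k a kls Da; apply: (Hh (k, a)).
Qed.

Lemma forces_all_finite h x v : heights h ->
  (forall u, w <= u -> domain u `<=` domain w) -> forces M w v (all_finite x).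
Proof.
move=> hP Dconst.
suff: forall ls', {subset ls' <= ls} -> forces M w v
    (foldr (fun k => And (All x (Imp (Imp (unary k x) Bot) Bot))) top ls').
  exact.
elim=> [|k ls' IH] sub /=; first by move=> u _ [].
split; last by apply: IH => l l_ls'; apply: sub; rewrite inE l_ls' orbT.
move=> u wu a /(Dconst _ wu) Da u' uu'.
have [_ hk] := hP k a (sub _ (mem_head _ _)) Da.
move=> /(_ (maxn u' (h k a)) (leq_maxl _ _)); apply; rewrite /= eqxx.
apply/hk; last exact: leq_maxr.
by rewrite leq_max (leq_trans wu uu').
Qed.

Lemma not_some_low h x v : heights h -> ~ forces M w v (some_low x).
Proof.
move=> hP.
suff: forall ls', {subset ls' <= ls} -> ~ forces M w v
    (foldr (fun k => Or (Ex x (unary k x))) Bot ls').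
  exact.
elim=> [|k ls' IH] sub //= [[a Da]|]; last first.
  by apply: IH => l l_ls'; apply: sub; rewrite inE l_ls' orbT.
rewrite /= eqxx; have [wh hk] := hP k a (sub _ (mem_head _ _)) Da.
by move=> /(hk _ (leqnn w)); rewrite leqNgt wh.
Qed.

End Heights.

(** * Rule systems as two-variable comparisons of heights *)

Definition QEq k s l t : hformula := QAnd (QLe k s l t) (QLe l t k s).

Lemma holds_eq T (D : set T) h v k s l t :
  holds D h v (QEq k s l t) <-> h k (v s) = h l (v t).
Proof.
by split=> [[/= le ge]|/= ->] //; apply/eqP; rewrite eqn_leq le ge.
Qed.

Definition zero_letter : nat := 0.
Definition number_letter : nat := 1.
(** Even and odd codes keep the letters of fields and of kinds apart. *)
Definition arg_letter (i : nat) : nat := i.*2.+2.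
Definition kind_letter (p : kind) : nat := (pickle p).*2.+3.

Section Describe.

Variables x y : nat.

Fixpoint same_args (k : nat) (s : seq nat) : hformula :=
  if s is i :: s' then
    QAnd (QEq (arg_letter k) y (arg_letter i) x) (same_args k.+1 s')
  else QTriv.

(** Being of kind p is encoded by comparing with the zero letter, so that its
    negation is a positive formula as well (see describe_rule). *)
Definition of_kind (p : kind) (z : nat) : hformula :=
  QLe (kind_letter p) z zero_letter z.

(** The variable x denotes the present fact, and y ranges over the fact called
    or over the individuals whose number heights must stay out of a gap. *)
Fixpoint describe (c : condition) : hformula :=
  match c with
  | CTriv => QTriv
  | CEq i j => QEq (arg_letter i) x (arg_letter j) x
  | CZero i => QEq (arg_letter i) x zero_letter x
  | CSucc i j =>
      QAnd (QLt (arg_letter i) x (arg_letter j) x)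
        (QAnd (QEx y (QEq number_letter y (arg_letter i) x))
           (QAll y (QOr (QLe number_letter y (arg_letter i) x)
                      (QLe (arg_letter j) x number_letter y))))
  | CCall q s => QEx y (QAnd (of_kind q y) (same_args 0 s))
  | CBoth c d => QAnd (describe c) (describe d)
  | CEither c d => QOr (describe c) (describe d)
  end.

Definition describe_rule (r : rule) : hformula :=
  QAll x (QOr (QLt zero_letter x (kind_letter r.1) x) (describe r.2)).

(** The last conjunct puts the zero heights at rank 0. *)
Definition describe_rules (rs : seq rule) : hformula :=
  foldr (fun r => QAnd (describe_rule r))
    (QAll x (QAll y (QLe zero_letter x number_letter y))) rs.

(** One quantifier would suffice to pass the value of a field to another
    individual; the second one brings it back to the variable x, so that hops
    can be iterated in two variables. *)
Definition hop (i : nat) (c : hformula) : hformula :=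
  QEx y (QAnd (QEq (arg_letter 0) y (arg_letter i) x)
    (QEx x (QAnd (QEq (arg_letter 0) x (arg_letter 0) y) c))).

Definition numeral_step (c : hformula) : hformula :=
  QAnd (describe (CSucc 1 0)) (hop 1 c).

(** Each step requires the predecessor of field 0 in field 1 and passes it to
    field 0 of another individual; arriving at zero after n steps makes n the
    rank of the first field 0. *)
Definition numeral (n : nat) : hformula :=
  iter n numeral_step (describe (CZero 0)).

Definition start (n : nat) : hformula :=
  QEx x (QAnd (of_kind [::] x) (hop 0 (numeral n))).

Definition system (rs : seq rule) (n : nat) : hformula :=
  QAnd (describe_rules rs) (start n).

Hypothesis neq_xy : x <> y.

Let xy : (x == y) = false. Proof. exact/eqP. Qed.
Let yx : (y == x) = false. Proof. by rewrite eq_sym. Qed.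

Section Extract.

Variables (T : Type) (D : set T) (h : nat -> T -> nat).

(** Heights used by the model need not be consecutive. Counting the number
    heights below t forgets the gaps, so that order-theoretic successors become
    numerical ones. *)
Definition rank (t : nat) : nat :=
  count (fun s => `[< exists2 a, D a & h number_letter a = s >]) (iota 0 t).

Lemma rank_eq0 t : (forall a, D a -> t <= h number_letter a) -> rank t = 0.
Proof.
move=> tle; apply/eqP; rewrite -leqn0 leqNgt -has_count; apply/hasPn => s.
rewrite mem_iota => /= lt_st; apply/asboolP => -[a /tle].
by move=> + aE; rewrite aE leqNgt lt_st.
Qed.

Lemma rank_next s t : (exists2 a, D a & h number_letter a = s) -> s < t ->
  (forall a, D a -> h number_letter a <= s \/ t <= h number_letter a) ->
  rank t = (rank s).+1.
Proof.
move=> sD lt_st gap.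
rewrite /rank -(subnKC (ltnW lt_st)) iotaD count_cat add0n -addn1.
congr (_ + _); rewrite -(subnSK lt_st) /= asboolT // -[RHS]addn0.
congr (_ + _); apply/eqP; rewrite -leqn0 leqNgt -has_count; apply/hasPn => z.
rewrite mem_iota subnKC // => /andP[lt_sz lt_zt].
apply/asboolP => -[a /gap+ aE].
by rewrite aE leqNgt lt_sz leqNgt lt_zt; case.
Qed.

Definition rank_arg (a : T) (i : nat) : nat := rank (h (arg_letter i) a).

Definition fact_of (p : kind) (a : T) : Prop :=
  D a /\ h (kind_letter p) a <= h zero_letter a.

Lemma holds_same_args v k s :
  holds D h v (same_args k s) <->
  [seq h (arg_letter i) (v y) | i <- iota k (size s)] =
  [seq h (arg_letter i) (v x) | i <- s].
Proof.
elim: s k => [|i s IH] k //=.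
split=> [[/(holds_eq D h v) -> /IH ->] //|[ki /IH]].
by split=> //; apply/(holds_eq D h v).
Qed.

Hypothesis zero_min : forall a b,
  D a -> D b -> h zero_letter a <= h number_letter b.

Lemma describe_sound v c :
  D (v x) -> holds D h v (describe c) -> meets rank_arg fact_of (v x) c.
Proof.
move=> Dx; elim: c => [|i j|i|i j|q s|c IHc d IHd|c IHc d IHd].
- by [].
- by move=> /holds_eq; rewrite /= /rank_arg => ->.
- move=> /holds_eq; rewrite /= /rank_arg => ->.
  by apply: rank_eq0 => a; apply: zero_min.
- move=> [lt_ij [[a Da /(holds_eq D)]]]; rewrite /= eqxx xy => aE gap.
  by apply: rank_next => //; exists a.
- move=> [a Da [Ka /holds_same_args]]; rewrite /= eqxx xy => sE.
  rewrite /= eqxx in Ka.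
  exists a => //; rewrite /mkseq /rank_arg.
  by rewrite (map_comp rank) sE -map_comp.
- by move=> [/IHc ? /IHd].
- by move=> [/IHc|/IHd]; [left|right].
Qed.

Lemma hop_sound v i c : holds D h v (hop i c) ->
  exists2 v', D (v' x) /\ holds D h v' c &
    rank_arg (v' x) 0 = rank_arg (v x) i.
Proof.
move=> [a Da [/(holds_eq D) aE [b Db [/(holds_eq D) bE Hc]]]].
exists [eta [eta v with y |-> a] with x |-> b].
  by split => //=; rewrite eqxx.
by move: aE bE; rewrite /rank_arg /= ?eqxx ?xy ?yx ?eqxx => <- <-.
Qed.

Lemma numeral_sound v n :
  D (v x) -> holds D h v (numeral n) -> rank_arg (v x) 0 = n.
Proof.
elim: n v => [|n IHn] v Dx; first exact: (@describe_sound _ (CZero 0)).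
move=> [/(@describe_sound _ (CSucc 1 0) Dx) /= -> /hop_sound[v' [Dx' Hn] <-]].
by rewrite (IHn v').
Qed.

End Extract.

Lemma system_sound T (D : set T) h v rs n :
  holds D h v (system rs n) ->
  exists (val : T -> nat -> nat) (U : kind -> T -> Prop) a,
    [/\ supported val U rs, U [::] a & val a 0 = n].
Proof.
move=> [Hrs [a Da [Ka Hn]]].
have zero_min : forall a b, D a -> D b -> h zero_letter a <= h number_letter b.
  elim: rs Hrs => [|r rs IH] /=; last by case=> _ /IH.
  move=> H b c Db Dc; have := H b Db c Dc.
  by rewrite /= !eqxx xy.
exists (rank_arg D h), (fact_of D h), a; split.
- elim: rs Hrs => //= r rs IH [Hr /IH]; split=> // b [Db Kb].
  case: (Hr b Db) => [|/(describe_sound zero_min)]; last first.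
    by rewrite /= eqxx; apply.
  by rewrite /= eqxx ltnNge Kb.
- by move: Ka; rewrite /= eqxx.
- have [v' [Dx' /(numeral_sound zero_min Dx') <-]] := hop_sound Hn.
  by rewrite /= eqxx.
Qed.

Definition decode (a : nat) : kind * seq nat :=
  odflt ([::], [::]) (unpickle a).

Lemma pickleK_decode pt : decode (pickle pt) = pt.
Proof. by rewrite /decode pickleK. Qed.

Section Build.

Variable U : kind -> seq nat -> Prop.

(** The individuals are the natural numbers. As a number height, a stands for
    itself, which makes every number available; through decode it also stands
    for a fact, whose kind letter is low only if the fact belongs to U. The
    final successor puts all heights above the world 0. *)
Definition standard (k a : nat) : nat :=
  (match k with
   | 0 => 0
   | 1 => a
   | k'.+2 =>
       if odd k' then
         ~~ ((pickle (decode a).1 == k'./2)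
             && `[< U (decode a).1 (decode a).2 >]) : nat
       else nth 0 (decode a).2 k'./2
   end).+1.

Lemma standard_arg i a : standard (arg_letter i) a = (nth 0 (decode a).2 i).+1.
Proof. by rewrite /standard /arg_letter odd_double doubleK. Qed.

Lemma standard_kind p a : standard (kind_letter p) a =
  (~~ (((decode a).1 == p) && `[< U (decode a).1 (decode a).2 >])).+1.
Proof.
rewrite /standard /kind_letter /= odd_double /= uphalf_double.
by rewrite (inj_eq (pcan_inj pickleK)).
Qed.

Lemma describe_complete v c :
  meets (nth 0) U (decode (v x)).2 c -> holds setT standard v (describe c).
Proof.
elim: c => [|i j|i|i j|q s|c IHc d IHd|c IHc d IHd].
- by [].
- by move=> /= E; apply/(holds_eq setT); rewrite !standard_arg E.
- by move=> /= E; apply/(holds_eq setT); rewrite !standard_arg E.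
- move=> E; rewrite /= in E.
  split; first by rewrite /= !standard_arg E.
  split.
    (* The value of field i, taken as an individual, has itself as number. *)
    exists (nth 0 (decode (v x)).2 i) => //; apply/(holds_eq setT).
    by rewrite /= eqxx xy standard_arg.
  move=> a _; rewrite /= eqxx xy !standard_arg E /standard /=.
  by case: (leqP a (nth 0 (decode (v x)).2 i)) => le; [left|right].
- move=> [t Ut sE]; exists (pickle (q, t)) => //; split.
    by rewrite /= eqxx standard_kind pickleK_decode /= eqxx asboolT.
  apply/holds_same_args; rewrite /= eqxx xy.
  under eq_map do rewrite standard_arg pickleK_decode.
  under [RHS]eq_map do rewrite standard_arg.
  by rewrite /= (map_comp succn) [RHS](map_comp succn) -sE.
- by move=> [/IHc ? /IHd].
- by move=> [/IHc|/IHd]; [left|right].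
Qed.

(** The individual reached may be any with the right field 0; choosing the
    predecessor for field 1 prepares the next step of a numeral. *)
Lemma hop_complete i c v k : nth 0 (decode (v x)).2 i = k ->
  (forall v', (decode (v' x)).2 = [:: k; k.-1] -> holds setT standard v' c) ->
  holds setT standard v (hop i c).
Proof.
move=> ik Hc; pose a := pickle (([::], [:: k; k.-1]) : kind * seq nat).
exists a => //; split.
  by apply/(holds_eq setT); rewrite /= eqxx xy !standard_arg pickleK_decode ik.
exists a => //; split; last by apply: Hc; rewrite /= eqxx pickleK_decode.
by apply/(holds_eq setT); rewrite /= eqxx yx eqxx.
Qed.

Lemma numeral_complete n v : (decode (v x)).2 = [:: n; n.-1] ->
  holds setT standard v (numeral n).
Proof.
elim: n v => [|n IHn] v vx.
  by apply: (@describe_complete _ (CZero 0)); rewrite vx.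
split; last by apply: hop_complete IHn; rewrite vx.
by apply: (@describe_complete _ (CSucc 1 0)); rewrite vx.
Qed.

Lemma system_complete v rs t : supported (nth 0) U rs -> U [::] t ->
  holds setT standard v (system rs (nth 0 t 0)).
Proof.
move=> Urs Ut; split.
  elim: rs Urs => [|r rs IH] /=; first by move=> _ a _ b _ /=; rewrite eqxx xy.
  case=> Ur /IH; split=> // a _ /=; rewrite /= eqxx.
  have [[p Ua]|nUa] := pselect ((decode a).1 = r.1 /\ U r.1 (decode a).2).
    by right; apply: describe_complete; rewrite /= eqxx; apply: Ur.
  left; rewrite standard_kind; case: eqP => //= ar.
  by rewrite asboolF // ar => Ua; apply: nUa.
exists (pickle (([::], t) : kind * seq nat)) => //; split.
  by rewrite /= eqxx standard_kind pickleK_decode /= asboolT.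
apply: (@hop_complete _ _ _ (nth 0 t 0)) => [|v']; last exact: numeral_complete.
by rewrite /= eqxx pickleK_decode.
Qed.

End Build.

End Describe.

Section Fragment.

Variables x y b : nat.

Let xP : x \in [:: x; y]. Proof. exact: mem_head. Qed.
Let yP : y \in [:: x; y]. Proof. by rewrite !inE eqxx orbT. Qed.

Lemma fragment_le k s l t : s \in [:: x; y] -> t \in [:: x; y] ->
  in_fragment x y b (formula (QLe k s l t)).
Proof. by move=> sP tP; rewrite /= !andbT; apply/andP. Qed.

Lemma fragment_lt k s l t : s \in [:: x; y] -> t \in [:: x; y] ->
  in_fragment x y b (formula (QLt k s l t)).
Proof. by move=> sP tP; rewrite /= !andbT -andbA andbb; apply/andP. Qed.

Lemma fragment_eq k s l t : s \in [:: x; y] -> t \in [:: x; y] ->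
  in_fragment x y b (formula (QEq k s l t)).
Proof. by move=> sP tP; apply/andP; split; apply: fragment_le. Qed.

Lemma fragment_same_args k s : in_fragment x y b (formula (same_args x y k s)).
Proof.
elim: s k => //= i s IH k; apply/andP; split; first exact: fragment_eq.
exact: IH.
Qed.

Lemma fragment_describe c : in_fragment x y b (formula (describe x y c)).
Proof.
elim: c => [|i j|i|i j|q s|c IHc d IHd|c IHc d IHd].
- by [].
- exact: fragment_eq.
- exact: fragment_eq.
- apply/andP; split; first exact: fragment_lt.
  apply/andP; split; apply/andP; split=> //; first exact: fragment_eq.
  by apply/andP; split; apply: fragment_le.
- apply/andP; split=> //; apply/andP; split; first exact: fragment_le.
  exact: fragment_same_args.
- exact/andP.
- exact/andP.
Qed.

Lemma fragment_hop i c : in_fragment x y b (formula c) ->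
  in_fragment x y b (formula (hop x y i c)).
Proof.
move=> cP; apply/andP; split=> //; apply/andP; split; first exact: fragment_eq.
by apply/andP; split=> //; apply/andP; split; first exact: fragment_eq.
Qed.

Lemma fragment_system rs n :
  in_fragment x y b (formula (system x y rs n)).
Proof.
apply/andP; split.
  elim: rs => [|r rs IH]; apply/andP; split=> //.
    by apply/andP; split=> //; apply: fragment_le.
  apply/andP; split=> //; apply/andP; split; first exact: fragment_lt.
  exact: fragment_describe.
apply/andP; split=> //; apply/andP; split; first exact: fragment_le.
apply: fragment_hop; elim: n => [|n IHn].
  exact: (fragment_describe (CZero 0)).
apply/andP; split; first exact: (fragment_describe (CSucc 1 0)).
exact: fragment_hop.
Qed.

Lemma fragment_all_finite ls : in_fragment x y b (all_finite ls x).
Proof. by elim: ls => //= k ls ->; rewrite mem_head. Qed.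

Lemma fragment_some_low ls : in_fragment x y b (some_low ls x).
Proof. by elim: ls => //= k ls ->; rewrite mem_head. Qed.

(** This bound allows all_finite and some_low to be the same for all n, which
    leaves the numeral as the only part of the refuted implication that varies
    with n. *)
Lemma letters_numeral n :
  {subset letters (numeral x y n) <= letters (numeral x y 1)}.
Proof.
have lettersE c : letters (numeral_step x y c) =
    letters (numeral_step x y QTriv) ++ letters c by [].
elim: n => [|n IHn] z zn; rewrite [numeral x y 1]/= lettersE mem_cat.
  by rewrite zn orbT.
move: zn; rewrite [numeral x y n.+1]/= lettersE mem_cat => /orP[->//|/IHn].
by rewrite [numeral x y 1]/= lettersE mem_cat.
Qed.

Lemma letters_system rs n :
  {subset letters (system x y rs n) <= letters (system x y rs 1)}.
Proof.
have lettersE m : letters (system x y rs m) =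
    letters (describe_rules x y rs)
      ++ letters (QAnd (of_kind [::] x) (hop x y 0 QTriv))
      ++ letters (numeral x y m) by [].
rewrite !lettersE; move: (@letters_numeral n).
move: (letters (numeral x y n)) (letters (numeral x y 1)) => ln l1 sub z.
by rewrite !mem_cat => /or3P[->|->|/sub ->]; rewrite ?orbT.
Qed.

End Fragment.


(** * Computability of the Goedel numbers *)

Lemma eq_computable_fun f g : f =1 g -> computable_fun f -> computable_fun g.
Proof. by move=> fg [c Hc]; exists c => v; rewrite -fg. Qed.

Lemma computable_succ : computable_fun succn.
Proof. by exists RSucc. Qed.

Lemma reval_comp1 n (f : recfun 1) (g : recfun n) v z y :
  reval g v z -> reval f [tuple z] y -> reval (RComp f (fun _ : 'I_1 => g)) v y.
Proof.
move=> Hz Hy; exists [tuple z] => // i.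
by rewrite (tnth_nth 0); case: i => -[|[]].
Qed.

Lemma computable_comp f g :
  computable_fun f -> computable_fun g -> computable_fun (f \o g).
Proof.
move=> [cf Hf] [cg Hg]; exists (RComp cf (fun _ : 'I_1 => cg)) => v.
exact: reval_comp1 (Hg v) (Hf _).
Qed.

Lemma computable_iter f b :
  computable_fun f -> computable_fun (fun n => iter n f b).
Proof.
move=> [cf Hf].
have [cb Hb] : exists cb : recfun 0, forall v, reval cb v b.
  elim: b => [|b [cb Hb]]; first by exists (RZero 0).
  exists (RComp RSucc (fun _ : 'I_1 => cb)) => v.
  exact: (reval_comp1 (f := RSucc) (Hb v)).
pose g := RComp cf (fun _ : 'I_1 => RProj (lift ord0 ord0 : 'I_2)).
exists (RPrec cb g) => v; case/tupleP: v => n u; rewrite theadE.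
elim: n => [|n IHn]; first exact/reval_prec0.
apply/reval_precS; exists (iter n f b) => //.
exact: reval_comp1 (Hf [tuple iter n f b]).
Qed.

Lemma computable_double : computable_fun double.
Proof.
apply: (@eq_computable_fun (fun n => iter n (succn \o succn) 0)).
  by elim=> // n IHn; rewrite iterS IHn doubleS.
by apply/computable_iter/computable_comp; apply: computable_succ.
Qed.

(** The code of a list is built from doublings and successors; a doubling
    iterated n times multiplies by a power of 2, so that unary functions
    suffice. *)
Lemma computable_code f s s' : computable_fun f ->
  computable_fun (fun n => CodeSeq.code (s ++ f n :: s')).
Proof.
have iter_double a m : iter a double m = 2 ^ a * m.
  by elim: a => [|a IHa]; rewrite ?mul1n // iterS IHa expnS -mul2n mulnA.
move=> Hf; elim: s => [|a s IHs] /=.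
  apply: (@eq_computable_fun
    ((fun n => iter n double (CodeSeq.code s').*2.+1) \o f)).
    by move=> n; apply: iter_double.
  by apply: computable_comp => //; apply/computable_iter/computable_double.
have: computable_fun
    (succn \o (double \o (fun n => CodeSeq.code (s ++ f n :: s')))).
  apply: computable_comp computable_succ _.
  exact: computable_comp computable_double _.
elim: a => [|a IHa] H.
  by apply: eq_computable_fun H => n /=; rewrite mul1n.
apply: eq_computable_fun (computable_comp computable_double (IHa H)) => n /=.
by rewrite -mul2n mulnA expnS.
Qed.

(** * The reduction *)

Definition refutation (x y : nat) (rs : seq rule) (n : nat) : form :=
  Imp (And (all_finite (letters (system x y rs 1)) x)
           (formula (system x y rs n)))
      (some_low (letters (system x y rs 1)) x).

Lemma fragment_refutation x y b rs n : fragment x y b (refutation x y rs n).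
Proof.
rewrite /fragment /= fragment_all_finite fragment_some_low andbT.
exact: fragment_system.
Qed.

(** Each formula constructor above the numeral only wraps its Goedel number in
    a list code with constant entries, and a numeral iterates such wrapping. *)
Lemma computable_refutation x y rs :
  computable_fun (goedel \o refutation x y rs).
Proof.
rewrite /refutation; move: (letters _) => ls.
have computable_And a f : computable_fun f ->
    computable_fun (fun n => CodeSeq.code [:: 2; goedel a; f n]).
  exact: (@computable_code _ [:: 2; goedel a] [::]).
have computable_Ex z f : computable_fun f ->
    computable_fun (fun n => CodeSeq.code [:: 6; z; f n]).
  exact: (@computable_code _ [:: 6; z] [::]).
pose code_hop i g := CodeSeq.code [:: 6; y; CodeSeq.code
  [:: 2; goedel (formula (QEq (arg_letter 0) y (arg_letter i) x));
    CodeSeq.code [:: 6; x; CodeSeq.code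
      [:: 2; goedel (formula (QEq (arg_letter 0) x (arg_letter 0) y)); g]]]].
have hopE i c :
    goedel (formula (hop x y i c)) = code_hop i (goedel (formula c)).
  by [].
have computable_hop i f : computable_fun f ->
    computable_fun (fun n => code_hop i (f n)).
  by move=> Hf; apply/computable_Ex/computable_And/computable_Ex/computable_And.
have computable_numeral :
    computable_fun (fun n => goedel (formula (numeral x y n))).
  pose step g := CodeSeq.code
    [:: 2; goedel (formula (describe x y (CSucc 1 0))); code_hop 1 g].
  apply: (@eq_computable_fun
    (fun n => iter n step (goedel (formula (numeral x y 0))))).
    by elim=> // n IHn; rewrite iterS IHn.
  apply: computable_iter; apply: computable_And; apply: computable_hop.
  by exists (RProj ord0) => v; rewrite /thead.
apply: (@computable_code (fun n =>
  goedel (And (all_finite ls x) (formula (system x y rs n)))) [:: 4] [:: _]).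
apply: (computable_And); apply: (computable_And); apply: computable_Ex.
exact: (computable_And (formula (of_kind [::] x)) _
  (computable_hop 0 _ computable_numeral)).
Qed.

Section Kripke.

Variables (x y : nat) (neq_xy : x <> y) (rs : seq rule) (n : nat).

(** In the model of the standard heights a unary letter holds at a world from
    its height on. *)
Lemma refutable_of_supported (U : kind -> seq nat -> Prop) t :
  supported (nth 0) U rs -> U [::] t -> nth 0 t 0 = n ->
  ~ QSIL (const_aframe natframe (inhabits 0)) (refutation x y rs n).
Proof.
move=> Urs Ut tn; rewrite -tn => valid; set A := const_aframe _ _ in valid.
pose I (w : natframe) (k : nat) : set (seq nat) :=
  [set s | exists2 a, s = [:: a] & standard U k a <= w].
have Idom w k s : I w k s -> List.Forall (@dom natframe A w) s.
  by move=> [a -> _]; do 2!constructor.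
have Imono u w k : acc u w -> I u k `<=` I w k.
  by move=> uw s [a -> ua]; exists a => //; apply: leq_trans ua uw.
pose M := @Model natframe A I Idom Imono.
have hP ls : heights M 0 ls (standard U).
  move=> k a _ _; split=> // u _; split; last by exists a.
  by move=> [a' [->]].
have Dconst u : 0 <= u -> @dom natframe A u `<=` @dom natframe A 0 by [].
apply: (@not_some_low A M 0 _ (standard U) x (fun=> 0 : indiv A) (hP _)).
apply: (valid M 0 (fun=> 0) (fun _ _ => Logic.I) 0 (leqnn 0)); split.
  exact: forces_all_finite (hP _) Dconst.
apply: (forces_of_holds (hP _) Dconst (@letters_system _ _ _ _)) => //.
exact: system_complete Ut.
Qed.

(** A world where the implication fails is one where its antecedent is forced
    and no height has been reached, so the heights there satisfy the system. *)
Lemma supported_of_refutable : ~ QSILe natframe (refutation x y rs n) ->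
  exists F (val : F -> nat -> nat) (U : kind -> F -> Prop) a,
    [/\ supported val U rs, U [::] a & val a 0 = n].
Proof.
move=> nvalid; apply: contrapT => nsup; apply: nvalid => A M w v vD u wu.
move=> [fin Hsys]; apply: contrapT => nlow; apply: nsup.
have [h hP] := heights_exist fin nlow.
exists (indiv A).
apply: (system_sound neq_xy (h := h) (D := @dom natframe A u)).
apply: (holds_of_forces hP (@letters_system _ _ _ _) _ Hsys) => s sfv.
by apply: (dom_mono wu); apply: vD; rewrite mem_cat mem_cat sfv orbT.
Qed.

End Kripke.

Lemma reduction (L : set form) (x y b : nat) (X : set nat) (rs : seq rule) :
  QSILe natframe `<=` L -> L `<=` QSIL (const_aframe natframe (inhabits 0)) ->
  x <> y ->
  (forall n, ~ X n -> exists U t,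
     [/\ supported (nth 0) U rs, U [::] t & nth 0 t 0 = n]) ->
  (forall F val (U : kind -> F -> Prop) a,
     supported val U rs -> U [::] a -> ~ X (val a 0)) ->
  many_one_reducible X (goedel @` (L `&` fragment x y b)).
Proof.
move=> leL Lle neq_xy complete sound.
exists (goedel \o refutation x y rs); first exact: computable_refutation.
move=> n; split=> [Xn|[phi [Lphi _] /goedel_inj phiE]].
  exists (refutation x y rs n) => //; split; last exact: fragment_refutation.
  apply: leL; apply: contrapT => /(supported_of_refutable neq_xy).
  move=> [F [val [U [a [Urs Ua aE]]]]].
  by apply: (sound _ _ _ _ Urs Ua); rewrite aE.
apply: contrapT => /complete[U [t [Urs Ut tE]]].
by apply: (refutable_of_supported neq_xy Urs Ut tE); rewrite -phiE; apply: Lle.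
Qed.

Section Relation.

Variables (R : rel nat) (c : recfun 2).
Hypothesis cP : forall v : 2.-tuple nat,
  reval c v (R (tnth v ord0) (tnth v ord_max)).

Lemma reval_rel n m : reval c [tuple n; m] (R n m).
Proof. exact: (cP [tuple n; m]). Qed.

(** An initial fact has fields n, m and zero; it calls R at (n, m) with value
    zero, so that supporting it amounts to finding m. *)
Definition counterexample_rules : seq rule :=
  ([::], CBoth (CZero 2) (CCall [:: 0] [:: 2; 0; 1])) :: qualify 0 (rules c).

(** An initial fact has fields n and zero. Facts of kind [:: 1] have fields n,
    m, zero and m + 1; the rule supports the fact of m by that of m + 1,
    without end. *)
Definition refuted_from_rules : seq rule :=
  [:: ([::], CBoth (CZero 1) (CCall [:: 1] [:: 0; 1])),
      ([:: 1], CBoth (CZero 2)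
                 (CBoth (CCall [:: 0] [:: 2; 0; 1])
                    (CBoth (CSucc 1 3) (CCall [:: 1] [:: 0; 3]))))
    & qualify 0 (rules c)].

Lemma call_sound F (val : F -> nat -> nat) U :
  supported val U (qualify 0 (rules c)) -> forall a,
  meets val U a (CBoth (CZero 2) (CCall [:: 0] [:: 2; 0; 1])) ->
  R (val a 0) (val a 1) = false.
Proof.
move=> /supported_qualify/rules_sound Hc a [/= a2 [b /Hc Hb [b0 b1 b2]]].
have := Hb [tuple val a 0; val a 1]; rewrite b0 a2 /= b1 b2 => /(_ erefl) H.
by have := reval_functional (reval_rel (val a 0) (val a 1)) H; case: (R _ _).
Qed.

Lemma call_complete : exists2 T : kind -> seq nat -> Prop,
  supported (nth 0) T (rules c) &
  forall U s n m, (forall q, U (0 :: q) = T q) -> R n m = false ->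
    meets (nth 0) U [:: n, m, 0 & s]
      (CBoth (CZero 2) (CCall [:: 0] [:: 2; 0; 1])).
Proof.
have [T TS TC] := rules_complete c; exists T => // U s n m UT Rnm.
split=> //; have := reval_rel n m; rewrite Rnm => /TC[aux Taux].
by apply: (meets_call (s' := [:: 0; n; m]) (aux := aux)); rewrite ?UT.
Qed.

End Relation.

Theorem theorem7p3 (L : set form) (L_logic : superint_logic L)
    (QSILe_L : QSILe natframe `<=` L)
    (L_QSIL : L `<=` QSIL (const_aframe natframe (inhabits 0)))
    (x y : nat) (neq_xy : x <> y) (b : nat) :
  sigma01_hard (L `&` fragment x y b) /\ pi01_hard (L `&` fragment x y b).
Proof.
split=> X [R [c cP] XP].
- apply: (@reduction _ _ _ _ _ (refuted_from_rules c)) => //.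
    move=> n nX; have [T TS TC] := call_complete cP.
    have Rn m : R n m = false.
      by apply/negP => Rnm; apply: nX; apply/XP; exists m.
    pose U (p : kind) t := match p with
      | [::] => t = [:: n; 0] | 0 :: q => T q t
      | _ => exists m, t = [:: n; m; 0; m.+1]
      end.
    exists U, [:: n; 0]; split=> //; split.
      move=> _ ->; split=> //; exists [:: n; 0; 0; 1] => //; exact: ex_intro.
    split; last exact/supported_qualify.
    move=> _ [m ->]; have [Hz Hc] := TC U [:: m.+1] n m (fun=> erefl) (Rn m).
    split=> //; split=> //; split=> //.
    by exists [:: n; m.+1; 0; m.+2] => //; exists m.+1.
  move=> F val U a [start [next /(call_sound cP) call]] Ua /XP[m].
  (* The infinite regress of the second rule visits every m. *)
  suff [d Ud [<- <-]] : exists2 d,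
      U [:: 1] d & val d 0 = val a 0 /\ val d 1 = m.
    by have [z [Hc _]] := next _ Ud; rewrite call.
  elim: m => [|m [d Ud [d0 dm]]].
    by have [az [d Ud [d0 d1]]] := start _ Ua; exists d; rewrite ?d0 ?d1.
  have [_ [_ [d3 [e Ue [e0 e1]]]]] := next _ Ud.
  by exists e; rewrite // e0 e1 d0 -dm.
- apply: (@reduction _ _ _ _ _ (counterexample_rules c)) => //.
    move=> n nX; have [T TS TC] := call_complete cP.
    have [m Rnm] : exists m, R n m = false.
      apply: contrapT => nR; apply: nX; apply/XP => m.
      by apply/negPn/negP => /negbTE Rnm; apply: nR; exists m.
    pose U (p : kind) t := match p with
      | [::] => t = [:: n; m; 0] | _ :: q => T q t
      end.
    exists U, [:: n; m; 0]; split=> //; split; last exact/supported_qualify.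
    by move=> _ ->; apply: (TC U).
  move=> F val U a [start /(call_sound cP) call] Ua /XP/(_ (val a 1)).
  by rewrite call //; apply: start.
Qed.
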